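(* Let $\mathbb F$ be a field and $n$ a positive integer. (1) Let $\mathcal L$ be a ladder of size $n$ and let $t=|\gamma_{\mathcal L}|+1$. Then $\mathcal L$ is DUT if and only if for each $i\in[t-1]$ at least one of $(i,i)$ and $(i+1,i+1)$ is in $[I(\mathcal L)]$. In particular, if $\mathcal L$ is DUT then $(i,j)\in[I(\mathcal L)]$ for all $i,j\in[t]$ with $i<j$. (2) Equivalently, $M_{\mathcal L}$ is a set of DUT ladder matrices (i.e. $\mathcal L$ is DUT) if and only if $M_{\mathcal L}$ can be obtained by removing some non-consecutive diagonal blocks from the set of block upper triangular matrices corresponding to a partition of $[n]$; that is, if and only if there are a partition of $[n]$ into $r$ consecutive intervals (for some $r\in[n]$) and a set $S\subseteq[r]$ containing no two consecutive integers such that $M_{\mathcal L}$ is the set of all matrices in $M_n$ that are block upper triangular with respect to this partition and whose $(k,k)$ block is zero for every $k\in S$.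
   Context: Notation: $[m]=\{1,\dots,m\}$ ($[0]=\emptyset$); $M_n$ is the set of $n\times n$ matrices over $\mathbb F$; $E_{ij}$ is the matrix unit. On pairs of positive integers, $(i_1,j_1)\succeq(i_2,j_2)$ (''$(i_1,j_1)$ dominates $(i_2,j_2)$'', also written $(i_2,j_2)\preceq(i_1,j_1)$) means $i_1\ge i_2$ and $j_1\le j_2$. A ladder of size $n$ is a (possibly empty) subset $\mathcal L=\{(i_1,j_1),\dots,(i_s,j_s)\}\subseteq[n]\times[n]$ with $i_1<\cdots<i_s$ and $j_1<\cdots<j_s$. Put $I(\mathcal L)=\{(i,j)\in[n]\times[n]:(i,j)\preceq(i_\ell,j_\ell)\text{ for some }\ell\in[s]\}$ and $M_{\mathcal L}=\sum_{(i,j)\in I(\mathcal L)}\mathbb F E_{ij}$, with $M_\emptyset=\{0\}$. $\mathcal L$ is dominant upper triangular (DUT) if $j_\ell\le i_\ell$ for all $\ell\in[s]$ and $i_\ell<j_{\ell+1}$ for all $\ell\in[s-1]$; in that case the matrices in $M_{\mathcal L}$ are called DUT ladder matrices. The partition of $\mathcal L$ is the partition of $[n]$ into consecutive intervals with cuts right after the elements of $\gamma_{\mathcal L}=\big(\{i_1,\dots,i_s\}\cup\{j_1-1,\dots,j_s-1\}\big)\setminus\{0,n\}$. With $t=|\gamma_{\mathcal L}|+1$, matrices in $M_n$ are viewed as $t\times t$ block matrices for this partition, and $[I(\mathcal L)]\subseteq[t]\times[t]$ is the set of indices of blocks that are nonzero in $M_{\mathcal L}$.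
   Formalization: In (1), the right-hand side of the ''if and only if'' also requires M_L to be block upper triangular for the partition of L; without this the ''if'' part fails, e.g. n=3, L={(2,1),(3,2)}, where all diagonal blocks are nonzero but L is not DUT. *)

(* Defs.v *)
From mathcomp Require Import all_boot all_order all_algebra.

Set Implicit Arguments.
Unset Strict Implicit.
Unset Printing Implicit Defensive.

Import GRing.Theory.

(* A pair (i, j) of positive integers is a pair of nats. Rows, columns and
   block indices are numbered from 1, so that the row or column a : 'I_n of a
   matrix carries the number a.+1. *)

Definition dominates (p q : nat * nat) : bool := (q.1 <= p.1) && (p.2 <= q.2).

(* The list [:: (i_1, j_1); ...; (i_s, j_s)] is the (unique) increasing
   enumeration of the ladder. *)
Definition is_ladder (n : nat) (L : seq (nat * nat)) : bool :=
  all (fun p => (1 <= p.1 <= n) && (1 <= p.2 <= n)) L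
  && sorted (fun p q => (p.1 < q.1) && (p.2 < q.2)) L.

Definition ladder_indices (n : nat) (L : seq (nat * nat)) :
    {set 'I_n * 'I_n} :=
  [set x : 'I_n * 'I_n |
    has (fun p => dominates p ((x.1 : nat).+1, (x.2 : nat).+1)) L].

Definition ladder_space (F : fieldType) (n : nat) (L : seq (nat * nat)) :
    {vspace 'M[F]_n} :=
  (\sum_(x in ladder_indices n L) <[delta_mx x.1 x.2]>)%VS.

Definition DUT (L : seq (nat * nat)) : bool :=
  all (fun p => p.2 <= p.1) L && sorted (fun p q => p.1 < q.2) L.

(* A partition of {1, ..., n} into consecutive intervals is the set C of its
   cuts, where a cut c, 0 < c < n, separates c from c.+1. *)
Definition is_cut_set (n : nat) (C : {set 'I_n.+1}) : bool :=
  (ord0 \notin C) && (ord_max \notin C).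

Definition nblocks (n : nat) (C : {set 'I_n.+1}) : nat := #|C|.+1.

Definition block_of (n : nat) (C : {set 'I_n.+1}) (a : 'I_n) : nat :=
  #|[set c in C | c < a.+1]|.+1.

Definition gamma (n : nat) (L : seq (nat * nat)) : {set 'I_n.+1} :=
  [set c : 'I_n.+1 | has (fun p => (c == p.1 :> nat) || (c == p.2.-1 :> nat)) L]
    :\: [set ord0; ord_max].

Definition block_zero (F : fieldType) (n : nat) (C : {set 'I_n.+1})
    (k m : nat) (A : 'M[F]_n) : Prop :=
  forall a b : 'I_n, block_of C a = k -> block_of C b = m -> A a b = 0%R.

Definition block_upper (F : fieldType) (n : nat) (C : {set 'I_n.+1})
    (A : 'M[F]_n) : Prop :=
  forall k m : nat, m < k -> block_zero C k m A.

(* (k, m) \in [I(L)] *)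
Definition nonzero_block (F : fieldType) (n : nat) (L : seq (nat * nat))
    (k m : nat) : Prop :=
  exists2 A : 'M[F]_n, A \in ladder_space F n L
                     & ~ block_zero (gamma n L) k m A.

(* The condition on diagonal blocks does not by itself imply DUT: for n = 3
   and L = {(2, 1), (3, 2)}, every diagonal block is nonzero in M_L, but L is
   not DUT, and M_L has a nonzero (2, 1) entry. The characterization of DUT
   ladders by diagonal blocks is correct among the ladders for which M_L is
   block upper triangular, which is what this predicate says. *)
Definition block_upper_ladder (F : fieldType) (n : nat)
    (L : seq (nat * nat)) : Prop :=
  forall A : 'M[F]_n, A \in ladder_space F n L -> block_upper (gamma n L) A.

(* Main.v *)
Require Import Defs.
From mathcomp Require Import all_boot all_order all_algebra zify.

(** Everything reduces to positions. A ladder space consists of the matrices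
    supported on the positions covered by the ladder [mem_ladder_spaceP], so a
    block is nonzero in it exactly when it meets a covered position
    [nonzero_blockP], and matrix units turn every statement about the space
    into one about the covered positions.

    On the combinatorial side, two facts do the work. The coordinates of a
    ladder increase together [ladder_mono], which limits the elements that can
    cover a position close to a given ladder element. And two indices x < y lie
    in different blocks of the partition of the ladder exactly when some ladder
    element p cuts between them: x <= p.1 < y or x < p.2 <= y [gamma_ltP].

    If L is DUT, the intervals [p.2, p.1] are nonempty, pairwise disjoint and
    increasing, so each is one block and its diagonal block is fully covered.
    Each cut is an end of such an interval, hence of two consecutive diagonal
    blocks one is covered; and a cut p.1 or p.2 - 1 between x and y puts (x, y)
    above and to the right of (p.1, p.2), so everything above the diagonal
    blocks is covered. A block touched by the ladder is entirely covered, since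
    the covered region only changes at cuts. This gives both forms of the
    characterization in the direction from DUT.

    Conversely, if p.1 < p.2 for some p in L, no position (x, y) with
    x >= p.1 and y < p.2, or with x > p.1 and y <= p.2, is covered, because p is
    the only candidate to cover it; this leaves two consecutive zero diagonal
    blocks. If q.2 <= p.1 for some p that precedes q, then the
    covered position (q.1, q.2) lies below the diagonal and straddles the cut
    p.1, against block triangularity; for an arbitrary partition it forces the
    position (q.1, p.2) into the support as well, where no ladder element can
    cover it. *)

(** * Ladders *)

(** The set I(L) with positions numbered from 1. *)
Definition covered (L : seq (nat * nat)) (x y : nat) : bool :=
  has (fun p => dominates p (x, y)) L.

Lemma coveredP {L x y} :
  reflect (exists2 p : nat * nat, p \in L & x <= p.1 /\ p.2 <= y) (covered L x y).
Proof.
apply: (iffP hasP) => [[p pL /andP[h1 h2]]|[p pL [h1 h2]]]; exists p => //.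
exact/andP.
Qed.

Lemma ladder_bounds {n L} {p : nat * nat} :
  is_ladder n L -> p \in L -> (0 < p.1 <= n) && (0 < p.2 <= n).
Proof. by case/andP=> /allP h _ /h. Qed.

Lemma ladder_pairwise {n L} :
  is_ladder n L -> pairwise (fun p q => (p.1 < q.1) && (p.2 < q.2)) L.
Proof. by case/andP=> _; rewrite sorted_pairwise // => p q r; lia. Qed.

Lemma pairwise_cases {T : eqType} {r : rel T} {s : seq T} {x y} :
  pairwise r s -> x \in s -> y \in s -> [|| x == y, r x y | r y x].
Proof.
elim: s => //= z s IHs /andP[/allP zs ps]; rewrite !inE.
case/predU1P=> [->|xs] /predU1P[->|ys]; rewrite ?eqxx ?IHs //.
  by rewrite zs ?orbT.
by rewrite zs ?orbT.
Qed.

Lemma ladder_mono {n L} {p q : nat * nat} :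
  is_ladder n L -> p \in L -> q \in L -> (p.1 < q.1) = (p.2 < q.2).
Proof.
move=> /ladder_pairwise hL pL qL.
by case/or3P: (pairwise_cases hL pL qL) => [/eqP->||] /=; lia.
Qed.

(** The gap condition on consecutive elements passes to all pairs because the
    relation p.1 < q.2 is transitive on elements with q.2 <= q.1. *)
Lemma DUTP {n L} : is_ladder n L ->
  reflect ((forall p : nat * nat, p \in L -> p.2 <= p.1) /\
           (forall p q : nat * nat, p \in L -> q \in L -> p.1 < q.1 -> p.1 < q.2))
          (DUT L).
Proof.
move=> hL; have hp := ladder_pairwise hL.
have trL : {in (fun p : nat * nat => p.2 <= p.1) & &,
            transitive (fun p q : nat * nat => p.1 < q.2)}.
  by move=> p q r; rewrite /in_mem /=; lia.
apply: (iffP andP) => [[diagL]|[diagL sepL]].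
  rewrite (sorted_pairwise_in trL) // => sepL; split; first exact/allP.
  move=> p q pL qL lt_pq.
  case/or3P: (pairwise_cases sepL pL qL) => [/eqP epq|//|/=].
    by move: lt_pq; rewrite epq ltnn.
  by have := allP diagL p pL; have := allP diagL q qL; lia.
have diag_all : all (fun p => p.2 <= p.1) L by apply/allP.
split=> //; rewrite (sorted_pairwise_in trL) //.
apply: (@sub_in_pairwise _ (mem L) _ _ _ L _ hp); last exact/allP.
by move=> p q pL qL /andP[lt_pq _]; apply: sepL.
Qed.

(** * The numbering of blocks *)

(** The function block_of on all naturals, numbered from 1 like the cuts:
    block_of C a is convertible to blk C a.+1. *)
Definition blk {n} (C : {set 'I_n.+1}) (x : nat) : nat :=
  #|[set c in C | c < x]|.+1.

Lemma blk_homo {n} (C : {set 'I_n.+1}) x y : x <= y -> blk C x <= blk C y.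
Proof.
move=> le_xy; apply/subset_leq_card/subsetP=> c; rewrite !inE => /andP[-> ?].
exact: leq_trans le_xy.
Qed.

Lemma blk_ltP {n} (C : {set 'I_n.+1}) x y :
  reflect (exists2 c : 'I_n.+1, c \in C & x <= c < y) (blk C x < blk C y).
Proof.
apply: (iffP idP) => [lt_xy|[c cC /andP[xc cy]]]; last first.
  have le_xy : x <= y by lia.
  rewrite ltnS; apply/proper_card/properP; split; last first.
    by exists c; rewrite !inE cC //= -leqNgt.
  by apply/subsetP=> d; rewrite !inE => /andP[-> ?]; apply: leq_trans le_xy.
have : ~~ ([set c in C | c < y] \subset [set c in C | c < x]).
  by apply: contraTN lt_xy => /subset_leq_card; rewrite -leqNgt.
case/subsetPn=> c; rewrite !inE => /andP[cC cy]; rewrite cC -leqNgt /= => xc.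
by exists c; rewrite ?xc.
Qed.

Lemma blk_step {n} (C : {set 'I_n.+1}) x : blk C x.+1 <= (blk C x).+1.
Proof.
rewrite /blk ltnS; have [lt_xn|le_nx] := ltnP x n.+1; last first.
  apply/leqW/subset_leq_card/subsetP=> c; rewrite !inE => /andP[-> _].
  exact: leq_trans (ltn_ord c) le_nx.
apply: leq_trans (_ : #|Ordinal lt_xn |: [set c in C | c < x]| <= _); last first.
  by rewrite cardsU1; case: (_ \notin _); rewrite ?leqnSn.
by apply/subset_leq_card/subsetP=> c; rewrite !inE -val_eqE /= => /andP[->]; lia.
Qed.

Lemma ord_of_pos {n x} : 0 < x <= n -> exists a : 'I_n, a.+1 = x.
Proof. by case: x => // x lt_xn; exists (Ordinal lt_xn). Qed.

(** Block numbers start at 1, end at nblocks C and grow by steps of at most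
    one, so none is skipped. *)
Lemma blk_surj {n} (C : {set 'I_n.+1}) k : 0 < n -> is_cut_set C ->
  1 <= k <= nblocks C -> exists2 x, 0 < x <= n & blk C x = k.
Proof.
move=> n_gt0 /andP[C0 Cn] /andP[k_gt0 kC].
have blk1 : blk C 1 = 1.
  congr _.+1; apply/eqP; rewrite cards_eq0; apply/eqP/setP=> c; rewrite !inE.
  apply: contraNF C0 => /andP[cC c0]; rewrite (_ : ord0 = c) //.
  by apply/val_inj => /=; lia.
have blkn : blk C n = nblocks C.
  congr _.+1; apply: eq_card => c; rewrite !inE.
  case cC: (c \in C) => //=; rewrite ltn_neqAle -ltnS ltn_ord andbT.
  by apply: contraNneq Cn => cn; rewrite (_ : ord_max = c) //; apply/val_inj.
have [x] : exists x, (0 < x <= n) && (k <= blk C x).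
  by exists n; rewrite n_gt0 leqnn blkn.
elim: x => [|x IHx] //; case/andP=> xn; have [kx _|xk kx] := leqP k (blk C x).
  case: (posnP x) => [x0|x_gt0]; last by apply: IHx; rewrite x_gt0 kx andbT; lia.
  (* The descent ends at the index 1, where the block number is 1: hence k is 1. *)
  exists 1; first by [].
  by have := blk_homo C x 1; rewrite x0 blk1 => /(_ isT); move: kx; rewrite x0; lia.
by exists x.+1 => //; have := blk_step C x; lia.
Qed.

(** * The partition of a ladder *)

Lemma gamma_is_cut_set n L : is_cut_set (gamma n L).
Proof. by rewrite /is_cut_set !inE !eqxx /= orbT. Qed.

Lemma nblocks_gamma n L : 0 < n -> nblocks (gamma n L) <= n.
Proof.
move=> n_gt0; have ne : (ord0 : 'I_n.+1) != ord_max by rewrite -val_eqE /=; lia.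
pose D : {set 'I_n.+1} := [set ord0; ord_max].
have eD : #|~: D|.+1 = n.
  by have := cardsC D; rewrite cards2 ne card_ord => -[].
rewrite /nblocks -[X in _ <= X]eD ltnS; apply/subset_leq_card/subsetP=> c.
by rewrite !inE => /andP[].
Qed.

(** Every number separating two indices in the range from 1 to n is neither 0
    nor n, so the separating cuts are exactly the bottom edges (p.1) and the
    left edges (p.2 - 1) of the regions of the ladder elements. *)
Lemma gamma_ltP {n L x y} : is_ladder n L -> 0 < x -> y <= n ->
  reflect (exists2 p : nat * nat, p \in L & (x <= p.1 < y) || (x < p.2 <= y))
          (blk (gamma n L) x < blk (gamma n L) y).
Proof.
move=> hL x_gt0 yn; apply: (iffP (blk_ltP _ _ _)) => [[c]|[p pL pxy]].
  rewrite !inE -!val_eqE /= => /andP[_ /hasP[p pL cp]] xcy; exists p => //.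
  by lia.
have pb := ladder_bounds hL pL.
have [c cE xcy] : exists2 c : nat, (c == p.1) || (c == p.2.-1) & x <= c < y.
  by case/orP: pxy => ?; [exists p.1 | exists p.2.-1]; rewrite ?eqxx ?orbT //; lia.
have lt_cn : c < n.+1 by lia.
exists (Ordinal lt_cn) => //=.
rewrite !inE -!val_eqE /=; apply/andP; split; first by lia.
by apply/hasP; exists p.
Qed.

Lemma gamma_lt_row {n L} {p : nat * nat} {x y} : is_ladder n L -> p \in L ->
  0 < x -> y <= n -> x <= p.1 < y -> blk (gamma n L) x < blk (gamma n L) y.
Proof. by move=> hL pL x0 yn pxy; apply/gamma_ltP => //; exists p; rewrite ?pxy. Qed.

Lemma gamma_lt_col {n L} {p : nat * nat} {x y} : is_ladder n L -> p \in L ->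
  0 < x -> y <= n -> x < p.2 <= y -> blk (gamma n L) x < blk (gamma n L) y.
Proof.
by move=> hL pL x0 yn pxy; apply/gamma_ltP => //; exists p; rewrite ?pxy ?orbT.
Qed.

(** A block that meets the covered region lies in it: the region of a single
    ladder element is bounded by cuts. *)
Lemma covered_blk {n L x y x' y'} : is_ladder n L ->
  0 < x <= n -> 0 < y <= n -> 0 < x' <= n -> 0 < y' <= n ->
  blk (gamma n L) x = blk (gamma n L) x' ->
  blk (gamma n L) y = blk (gamma n L) y' ->
  covered L x y -> covered L x' y'.
Proof.
move=> hL hx hy hx' hy' exx' eyy' /coveredP[p pL [xp py]].
apply/coveredP; exists p => //; split; rewrite leqNgt; apply/negP=> lt_p.
  have := gamma_lt_row hL pL (x := x) (y := x').
  by rewrite exx' ltnn => H; have : false by apply: H; lia.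
have := gamma_lt_col hL pL (x := y') (y := y).
by rewrite eyy' ltnn => H; have : false by apply: H; lia.
Qed.

(** * Covered positions and DUT ladders *)

Section DUTLadders.
Context {n : nat} {L : seq (nat * nat)} (hL : is_ladder n L).

(** A ladder element p that cuts between x and y satisfies p.2 <= p.1, so
    both x <= p.1 and p.2 <= y hold whichever of its two edges cuts. *)
Lemma DUT_covered_lt x y : DUT L -> 0 < x -> y <= n ->
  blk (gamma n L) x < blk (gamma n L) y -> covered L x y.
Proof.
case/(DUTP hL)=> diagL _ x_gt0 yn /(gamma_ltP hL x_gt0 yn)[p pL pxy].
by apply/coveredP; exists p => //; have := diagL p pL; lia.
Qed.

(** The interval from p.2 to p.1 contains no cut of the partition, because
    the intervals of the other elements are disjoint from it. *)
Lemma DUT_covered_le x y : DUT L -> x <= n -> 0 < y ->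
  covered L x y -> blk (gamma n L) x <= blk (gamma n L) y.
Proof.
case/(DUTP hL)=> diagL sepL xn y_gt0 /coveredP[p pL [xp py]].
rewrite leqNgt; apply/negP=> /(gamma_ltP hL y_gt0 xn)[q qL qxy].
have := ladder_mono hL pL qL; have := ladder_mono hL qL pL.
have := sepL p q pL qL; have := sepL q p qL pL; lia.
Qed.

(** Any element cutting between two consecutive blocks has its corner
    p.1 at the end of the first one or p.2 at the start of the second one. *)
Lemma DUT_diag k : 0 < n -> DUT L -> 1 <= k -> k < nblocks (gamma n L) ->
  exists2 x, 0 < x <= n & covered L x x /\
    (blk (gamma n L) x = k \/ blk (gamma n L) x = k.+1).
Proof.
move=> n_gt0 dL k_gt0 kt.
have [x hx ex] := blk_surj _ k n_gt0 (gamma_is_cut_set n L) ltac:(lia).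
have [y hy ey] := blk_surj _ k.+1 n_gt0 (gamma_is_cut_set n L) ltac:(lia).
have : blk (gamma n L) x < blk (gamma n L) y by rewrite ex ey.
have [x_gt0 _] := andP hx; have [_ yn] := andP hy.
case/(gamma_ltP hL x_gt0 yn)=> p pL.
have pb := ladder_bounds hL pL.
have [diagL _] := DUTP hL dL; have pd := diagL p pL.
case/orP=> pxy; [exists p.1; first by lia | exists p.2; first by lia].
  split; first by apply/coveredP; exists p.
  have := gamma_lt_row hL pL (x := p.1) (y := y); rewrite ey => H.
  have := H _ _ _; rewrite -ex; left; apply/eqP; rewrite eqn_leq.
  rewrite [X in _ && X]blk_homo ?andbT; last by lia.
  by rewrite -ltnS ex; apply: H; lia.
split; first by apply/coveredP; exists p.
have := gamma_lt_col hL pL (x := x) (y := p.2); rewrite ex => H.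
right; apply/eqP; rewrite eqn_leq -{1}ey blk_homo /=; last by lia.
by apply: H; lia.
Qed.

(** If p.1 < p.2, the diagonal blocks on the two sides of the cut p.1 would
    both be zero; and a covered (q.1, q.2) with q.2 <= p.1 < q.1 would be
    below the block diagonal. *)
Lemma DUT_of_diag :
  (forall x y, 0 < x <= n -> 0 < y <= n ->
     covered L x y -> blk (gamma n L) x <= blk (gamma n L) y) ->
  (forall k, 1 <= k -> k < nblocks (gamma n L) ->
     exists x y, [/\ 0 < x <= n, 0 < y <= n, covered L x y,
       blk (gamma n L) x = blk (gamma n L) y &
       blk (gamma n L) x = k \/ blk (gamma n L) x = k.+1]) ->
  DUT L.
Proof.
move=> upL diagL; apply/(DUTP hL); split=> [p pL|p q pL qL lt_pq].
  have pb := ladder_bounds hL pL.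
  rewrite leqNgt; apply/negP=> lt_p.
  have lt_blk : blk (gamma n L) p.1 < blk (gamma n L) p.1.+1.
    by apply: (gamma_lt_row hL pL); lia.
  have eS : blk (gamma n L) p.1.+1 = (blk (gamma n L) p.1).+1.
    by have := blk_step (gamma n L) p.1; lia.
  have kt : blk (gamma n L) p.1 < nblocks (gamma n L).
    apply: leq_trans lt_blk _; rewrite ltnS; apply: subset_leq_card.
    by apply/subsetP=> c; rewrite inE => /andP[].
  have [x [y [hx hy /coveredP[q qL [xq qy]] exy exk]]] := diagL _ (ltn0Sn _) kt.
  have qb := ladder_bounds hL qL; have monoL := ladder_mono hL qL pL.
  have nlt : ~ (blk (gamma n L) x < blk (gamma n L) x) by rewrite ltnn.
  case: exk => exk.
    have [lt_qp|le_pq] := ltnP q.1 p.1.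
      apply: nlt; rewrite {2}exk; apply: (gamma_lt_row hL qL); lia.
    apply: nlt; rewrite {1}exk exy; apply: (gamma_lt_col hL qL); lia.
  have [le_qp|lt_pq] := leqP q.1 p.1.
    apply: nlt; rewrite {2}exk -eS; apply: (gamma_lt_row hL qL); lia.
  have monoL' := ladder_mono hL pL qL.
  apply: nlt; rewrite {1}exk -eS exy; apply: (gamma_lt_col hL qL); lia.
have pb := ladder_bounds hL pL; have qb := ladder_bounds hL qL.
rewrite ltnNge; apply/negP=> le_qp.
have : blk (gamma n L) q.1 <= blk (gamma n L) q.2.
  by apply: upL; [lia | lia | apply/coveredP; exists q].
by rewrite leqNgt (gamma_lt_row hL pL) //; lia.
Qed.

(** Here the partition is unrelated to the ladder at first. If p.1 < p.2 then
    the uncovered positions (p.1, p.1), (p.2, p.2) and (p.1, p.2 - 1) show that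
    p.1 and p.2 lie in consecutive blocks of S. If q.2 <= p.1 for p before q,
    the covered positions (q.1, q.2) and (p.1, p.2) put p.2, q.2, p.1 and q.1
    in one block, so (q.1, p.2) should be covered, and it is not. *)
Lemma DUT_of_shape (C : {set 'I_n.+1}) (S : pred nat) :
  (forall k, S k -> ~~ S k.+1) ->
  (forall x y, 0 < x <= n -> 0 < y <= n ->
     covered L x y = (blk C x < blk C y) ||
                     ((blk C x == blk C y) && ~~ S (blk C x))) ->
  DUT L.
Proof.
move=> S_sparse covE; apply/(DUTP hL); split=> [p pL|p q pL qL lt_pq].
  have pb := ladder_bounds hL pL; rewrite leqNgt; apply/negP=> lt_p.
  have ncov x y : p.1 <= x -> y < p.2 -> ~~ covered L x y.
    move=> px yp; apply/coveredP=> -[q qL [xq qy]].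
    by have := ladder_mono hL qL pL; lia.
  have ncov' x y : p.1 < x -> y <= p.2 -> ~~ covered L x y.
    move=> px yp; apply/coveredP=> -[q qL [xq qy]].
    by have := ladder_mono hL pL qL; lia.
  have cov_p : covered L p.1 p.2 by apply/coveredP; exists p.
  have h1 := ncov p.1 p.1 (leqnn _) lt_p.
  have h2 := ncov' p.2 p.2 lt_p (leqnn _).
  have h3 := ncov p.1 p.2.-1 (leqnn _) ltac:(lia).
  move: cov_p h1 h2 h3; rewrite !covE ?ltnn ?eqxx /=; try lia.
  rewrite !negbK negb_or -leqNgt => cov_p S1 S2 /andP[le_blk _].
  have step := blk_step C p.2.-1; rewrite prednK in step; last by lia.
  have e2 : blk C p.2 = (blk C p.1).+1 by move: cov_p; rewrite S1 andbF; lia.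
  by have := S_sparse _ S1; rewrite -e2 S2.
have pb := ladder_bounds hL pL; have qb := ladder_bounds hL qL.
have monoL := ladder_mono hL pL qL.
rewrite ltnNge; apply/negP=> le_qp.
have cov_p : covered L p.1 p.2 by apply/coveredP; exists p.
have cov_q : covered L q.1 q.2 by apply/coveredP; exists q.
have ncov : ~~ covered L q.1 p.2.
  by apply/coveredP=> -[r rL [qr rp]]; have := ladder_mono hL rL qL; lia.
move: cov_p cov_q ncov; rewrite !covE; try lia.
have := blk_homo C p.2 q.2; have := blk_homo C q.2 p.1.
have := blk_homo C p.1 q.1; move=> m1 m2 m3 cov_p cov_q.
have e1 : blk C p.2 = blk C q.1 by lia.
have e2 : blk C q.2 = blk C q.1 by lia.
by move: cov_q; rewrite e1 e2 => ->.
Qed.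

End DUTLadders.

(** * Matrices *)

Lemma mem_ladder_spaceP {F : fieldType} {n L} {A : 'M[F]_n} :
  A \in ladder_space F n L <->
  (forall a b : 'I_n, ~~ covered L a.+1 b.+1 -> A a b = 0%R).
Proof.
split=> [/memv_sumP[v vL ->] a b nab|suppA].
  rewrite summxE big1 // => x xI; have /vlineP[c ->] := vL x xI.
  rewrite !mxE; case: eqP => [ea|]; last by rewrite GRing.mulr0.
  case: eqP => [eb|]; last by rewrite GRing.mulr0.
  by move: xI nab; rewrite inE ea eb => xI; rewrite /covered xI.
rewrite [A]matrix_sum_delta; apply: memv_suml => a _; apply: memv_suml => b _.
have [ab|nab] := boolP (covered L a.+1 b.+1); last first.
  by rewrite suppA // GRing.scale0r mem0v.
apply: memvZ; have abI : (a, b) \in ladder_indices n L by rewrite inE.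
exact: (subvP (sumv_sup (a, b) abI (subvv _))) (memv_line _).
Qed.

Lemma delta_mx_eq0 (F : fieldType) n (a b a' b' : 'I_n) :
  ((delta_mx a b : 'M[F]_n) a' b' = 0%R) <-> ~~ ((a' == a) && (b' == b)).
Proof.
rewrite mxE; case: (_ && _) => /=; last by [].
by split=> // /eqP; rewrite GRing.oner_eq0.
Qed.

Lemma delta_mx_ladder (F : fieldType) n L (a b : 'I_n) :
  (delta_mx a b \in ladder_space F n L) = covered L a.+1 b.+1.
Proof.
apply/idP/idP=> [/mem_ladder_spaceP suppA|cov_ab].
  apply/negPn/negP=> /suppA /delta_mx_eq0; by rewrite !eqxx.
apply/mem_ladder_spaceP=> a' b' ncov; apply/delta_mx_eq0.
by apply: contra ncov => /andP[/eqP-> /eqP->].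
Qed.

Lemma block_zero_delta (F : fieldType) n (C : {set 'I_n.+1}) k m (a b : 'I_n) :
  block_zero C k m (delta_mx a b : 'M[F]_n) <->
  ~~ ((blk C a.+1 == k) && (blk C b.+1 == m)).
Proof.
split=> [zA|nab a' b' ea eb].
  apply/andP=> -[/eqP ea /eqP eb].
  by have /delta_mx_eq0 := zA a b ea eb; rewrite !eqxx.
apply/delta_mx_eq0; apply: contra nab => /andP[/eqP<- /eqP<-].
by rewrite -ea -eb !eqxx.
Qed.

Lemma nonzero_blockP {F : fieldType} {n L k m} :
  nonzero_block F n L k m <->
  exists x y, [/\ 0 < x <= n, 0 < y <= n, covered L x y,
    blk (gamma n L) x = k & blk (gamma n L) y = m].
Proof.
split=> [[A AL nzA]|[x [y [hx hy cov_xy ex ey]]]].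
  have [/existsP[a /existsP[b /and3P[cov_ab /eqP ea /eqP eb]]]|nab] := boolP
    [exists a : 'I_n, exists b : 'I_n, [&& covered L a.+1 b.+1,
       blk (gamma n L) a.+1 == k & blk (gamma n L) b.+1 == m]].
    by exists a.+1, b.+1; split=> //; apply: ltn_ord.
  case: nzA => a b ea eb; move/mem_ladder_spaceP: AL; apply.
  apply: contra nab => cov_ab; apply/existsP; exists a; apply/existsP; exists b.
  by rewrite cov_ab -ea -eb !eqxx.
have [a ea] := ord_of_pos hx; have [b eb] := ord_of_pos hy.
exists (delta_mx a b); first by rewrite delta_mx_ladder ea eb.
by case/block_zero_delta/negP; rewrite ea eb ex ey !eqxx.
Qed.

Lemma block_upper_ladderP {F : fieldType} {n L} :
  block_upper_ladder F n L <->
  (forall x y, 0 < x <= n -> 0 < y <= n ->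
     covered L x y -> blk (gamma n L) x <= blk (gamma n L) y).
Proof.
split=> [upL x y hx hy cov_xy|upL A /mem_ladder_spaceP suppA k m lt_mk a b ea eb].
  have [a ea] := ord_of_pos hx; have [b eb] := ord_of_pos hy.
  have AL : (delta_mx a b : 'M[F]_n) \in ladder_space F n L.
    by rewrite delta_mx_ladder ea eb.
  rewrite leqNgt; apply/negP=> lt_yx.
  by have /block_zero_delta := upL _ AL _ _ lt_yx; rewrite ea eb !eqxx.
apply: suppA; apply: contraTN lt_mk => cov_ab; rewrite -leqNgt -ea -eb.
by apply: upL => //; apply: ltn_ord.
Qed.

(** Both conditions on A are tested on matrix units: the unit at (x, y) lies in
    one single block, which either belongs to the shape or is required to be
    zero. *)
Lemma covered_of_shape {F : fieldType} {n L} {C : {set 'I_n.+1}} {S : pred nat} :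
  (forall A : 'M[F]_n, A \in ladder_space F n L <->
     block_upper C A /\ forall k : nat, S k -> block_zero C k k A) ->
  forall x y, 0 < x <= n -> 0 < y <= n ->
    covered L x y = (blk C x < blk C y) ||
                    ((blk C x == blk C y) && ~~ S (blk C x)).
Proof.
move=> shapeL x y hx hy.
have [a ea] := ord_of_pos hx; have [b eb] := ord_of_pos hy.
rewrite -ea -eb -(delta_mx_ladder F); apply/idP/idP.
  case/shapeL=> upA zA; case: ltngtP => //= [lt_ba|e_ab].
    by have /block_zero_delta := upA _ _ lt_ba; rewrite !eqxx.
  by apply/negP=> /zA/block_zero_delta; rewrite e_ab !eqxx.
move=> cov_ab; apply/shapeL; split=> [k m lt_mk|k Sk].
  apply/block_zero_delta; apply/negP=> /andP[/eqP e1 /eqP e2].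
  by move: cov_ab; rewrite e1 e2; lia.
apply/block_zero_delta; apply/negP=> /andP[/eqP e1 /eqP e2].
by move: cov_ab; rewrite e1 e2 ltnn eqxx Sk.
Qed.

(** The removed diagonal blocks are those without covered position; every
    remaining block on or above the diagonal is covered entirely. *)
Lemma DUT_shape (F : fieldType) n L : 0 < n -> is_ladder n L -> DUT L ->
  exists (r : nat) (C : {set 'I_n.+1}) (S : pred nat),
    [/\ 1 <= r <= n,
        is_cut_set C /\ nblocks C = r,
        forall k : nat, S k -> 1 <= k <= r,
        forall k : nat, S k -> ~~ S k.+1
      & forall A : 'M[F]_n, A \in ladder_space F n L <->
          block_upper C A /\ forall k : nat, S k -> block_zero C k k A].
Proof.
move=> n_gt0 hL dL; set C := gamma n L.
pose cov_diag k := [exists a : 'I_n, exists b : 'I_n,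
  [&& covered L a.+1 b.+1, blk C a.+1 == k & blk C b.+1 == k]].
exists (nblocks C), C, (fun k => (1 <= k <= nblocks C) && ~~ cov_diag k).
split.
- by rewrite nblocks_gamma.
- by split=> //; apply: gamma_is_cut_set.
- by move=> k /andP[].
- move=> k /andP[/andP[k_gt0 _] nk]; apply/negP=> /andP[/andP[_ kt] nk1].
  have [x hx [cov_x ek]] := DUT_diag hL k n_gt0 dL k_gt0 kt.
  have [a ea] := ord_of_pos hx.
  case: ek => ek; [case/negP: nk | case/negP: nk1];
    by apply/existsP; exists a; apply/existsP; exists a;
       rewrite ea cov_x ek eqxx.
move=> A; split=> [AL|[upA zA]].
  split; first by move: A AL; apply/block_upper_ladderP => x y hx hy;
    apply: (DUT_covered_le hL) => //; lia.
  move=> k /andP[_ nk] a b ea eb; move/mem_ladder_spaceP: AL; apply.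
  apply: contra nk => cov_ab; apply/existsP; exists a; apply/existsP; exists b.
  by rewrite cov_ab /=; apply/andP; split; apply/eqP.
apply/mem_ladder_spaceP=> a b ncov.
have ha : 0 < a.+1 <= n by rewrite ltn_ord.
have hb : 0 < b.+1 <= n by rewrite ltn_ord.
case: (ltngtP (blk C a.+1) (blk C b.+1)) => [lt_ab|lt_ba|e_ab].
- by case/negP: ncov; apply: (DUT_covered_lt hL) => //; apply: ltn_ord.
- exact: (upA _ _ lt_ba).
apply: (zA (blk C a.+1)) => //; apply/andP; split.
  by apply/andP; split=> //; rewrite ltnS; apply: subset_leq_card;
     apply/subsetP=> c; rewrite inE => /andP[].
apply: contra ncov => /existsP[a' /existsP[b' /and3P[cov_ab' /eqP ea /eqP eb]]].
by apply: (covered_blk hL _ _ ha hb _ _ cov_ab'); rewrite ?ltn_ord // eb -e_ab.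
Qed.

Theorem theorem2p4 (F : fieldType) (n : nat) (hn : 0 < n)
    (L : seq (nat * nat)) (hL : is_ladder n L) :
  [/\ DUT L <->
        (block_upper_ladder F n L /\
         forall i : nat, 1 <= i -> i < nblocks (gamma n L) ->
           nonzero_block F n L i i \/ nonzero_block F n L i.+1 i.+1),
      DUT L ->
        forall i j : nat, 1 <= i -> i < j -> j <= nblocks (gamma n L) ->
          nonzero_block F n L i j
    & DUT L <->
        exists (r : nat) (C : {set 'I_n.+1}) (S : pred nat),
          [/\ 1 <= r <= n,
              is_cut_set C /\ nblocks C = r,
              forall k : nat, S k -> 1 <= k <= r,
              forall k : nat, S k -> ~~ S k.+1
            & forall A : 'M[F]_n,
                A \in ladder_space F n L <->
                block_upper C A /\ forall k : nat, S k -> block_zero C k k A]].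
Proof.
split.
- split=> [dL|[/block_upper_ladderP upL diagL]].
    split; first by apply/block_upper_ladderP => x y hx hy;
      apply: (DUT_covered_le hL) => //; lia.
    move=> k k_gt0 kt; have [x hx [cov_x ek]] := DUT_diag hL k hn dL k_gt0 kt.
    by case: ek => ek; [left | right]; apply/nonzero_blockP; exists x, x; split.
  apply: (DUT_of_diag hL upL) => k k_gt0 kt.
  case: (diagL k k_gt0 kt) => /nonzero_blockP[x [y [hx hy cov_xy ex ey]]];
    exists x, y; split; rewrite ?ex ?ey //; by [left | right].
- move=> dL i j i_gt0 lt_ij jt.
  have [x hx ex] := blk_surj _ i hn (gamma_is_cut_set n L) ltac:(lia).
  have [y hy ey] := blk_surj _ j hn (gamma_is_cut_set n L) ltac:(lia).
  apply/nonzero_blockP; exists x, y; split=> //.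
  by apply: (DUT_covered_lt hL) => //; rewrite ?ex ?ey //; lia.
split=> [|[r [C [S [_ _ _ S_sparse shapeL]]]]]; first exact: DUT_shape.
exact: (DUT_of_shape hL C S S_sparse (covered_of_shape shapeL)).
Qed.
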